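(* Let $n\ge 7$. Then the set $\{\eta(\Gamma(G)) : \Gamma(G) \text{ an unbalanced signed graph with } G\in B_n^+\}$ equals $\{0,1,2,\ldots,n-6\}$.
   Context: A signed graph $\Gamma(G)=(G,\sigma)$ consists of a simple graph $G$ and a map $\sigma:E(G)\to\{+,-\}$; its adjacency matrix has entry $\sigma(v_iv_j)$ for edges and $0$ otherwise, and $\eta(\Gamma(G))$ is the multiplicity of $0$ as an eigenvalue. A cycle is positive if it has an even number of negative edges; $\Gamma(G)$ is balanced if all its cycles are positive, and unbalanced otherwise. A bicyclic graph is a connected simple graph with $|E|=|V|+1$. The graph $\infty(p,q,l)$ ($p,q\ge3$, $l\ge1$) is obtained from vertex-disjoint cycles $C_p$, $C_q$ by joining a vertex of $C_p$ to a vertex of $C_q$ by a path on $l$ vertices (identifying the two vertices when $l=1$). $B_n^+$ is the set of bicyclic graphs on $n$ vertices obtained from some $\infty(p,q,l)$ with $l>1$ by (possibly) attaching trees to some of its vertices. *)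

(* Defs.v *)
From mathcomp Require Import all_boot all_order all_algebra.

Set Implicit Arguments.
Unset Strict Implicit.
Unset Printing Implicit Defensive.

Import Order.TTheory GRing.Theory Num.Theory.

Record sgraph (V : finType) := SGraph {
  adj : rel V;
  adj_sym : symmetric adj;
  adj_irr : irreflexive adj }.

Section SimpleGraphs.
Variables (V : finType) (G : sgraph V).

Definition edges : {set {set V}} :=
  [set [set x.1; x.2] | x : V * V & adj G x.1 x.2].

Definition adj_in (A : {set V}) : rel V :=
  [rel x y | [&& x \in A, y \in A & adj G x y]].

Definition connected_on (A : {set V}) : Prop :=
  A != set0 /\ {in A &, forall x y, connect (adj_in A) x y}.

(* The cyclic sequence of the vertices of a cycle, without repetition. *)
Definition is_cycle (c : seq V) : bool :=
  [&& cycle (adj G) c, uniq c & 2 < size c].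

Definition tree_on (A : {set V}) : Prop :=
  connected_on A /\ forall c, is_cycle c -> ~~ all [in A] c.

Definition bicyclic : Prop :=
  connected_on [set: V] /\ #|edges| = #|V|.+1.

End SimpleGraphs.

Section GraphOfRel.
Variables (V : finType) (e : rel V).

Definition adj_of_rel : rel V := [rel x y | (x != y) && (e x y || e y x)].

Fact adj_of_rel_sym : symmetric adj_of_rel.
Proof. by move=> x y; rewrite /adj_of_rel /= eq_sym orbC. Qed.

Fact adj_of_rel_irr : irreflexive adj_of_rel.
Proof. by move=> x; rewrite /adj_of_rel /= eqxx. Qed.

Definition graph_of_rel : sgraph V := SGraph adj_of_rel_sym adj_of_rel_irr.

End GraphOfRel.

Definition path_edge (a b : nat) : rel nat :=
  [rel i j | [&& a <= i, j <= b & j == i.+1]].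

Definition cycle_edge (a b : nat) : rel nat :=
  [rel i j | path_edge a b i j || ((i == a) && (j == b))].

(* The graph oo(p,q,l), for p, q >= 3 and l >= 1, with vertices labelled so   *)
(* that C_p is 0, ..., p-1, the l vertices of the joining path are            *)
(* p-1, ..., p+l-2, and C_q is p+l-2, ..., p+q+l-3. The end vertices of the   *)
(* path are thus the two joined vertices, which coincide when l = 1.          *)
Definition infty_graph (p q l : nat) : sgraph 'I_(p + q + l - 2) :=
  graph_of_rel (fun i j : 'I_(p + q + l - 2) =>
    [|| cycle_edge 0 (p - 1) i j,
        path_edge (p - 1) (p + l - 2) i j
      | cycle_edge (p + l - 2) (p + q + l - 3) i j]).

(* G is obtained from H by attaching to each vertex w of H a tree T_w (which  *)
(* may be reduced to w): f embeds H in G, the trees T_w are pairwise disjoint *)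
(* and cover G, r maps each vertex of G to the w such that T_w contains it,   *)
(* and the edges of G outside the T_w are those of H.                         *)
Definition attach_trees (W V : finType) (H : sgraph W) (G : sgraph V) : Prop :=
  exists (f : W -> V) (r : V -> W),
    [/\ cancel f r,
        forall w, tree_on G [set x | r x == w]
      & forall x y, r x != r y ->
          adj G x y = [&& x == f (r x), y == f (r y) & adj H (r x) (r y)]].

Definition Bplus (n : nat) (G : sgraph 'I_n) : Prop :=
  bicyclic G /\
  exists p q l : nat,
    [/\ 2 < p, 2 < q, 1 < l & attach_trees (infty_graph p q l) G].

(* The sign map E(G) -> {+,-} is given by its set of negative edges. *)
Record signed_graph (V : finType) := SignedGraph {
  underlying : sgraph V;
  neg : rel V;
  neg_sym : symmetric neg;
  neg_adj : subrel neg (adj underlying) }.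

Section SignedGraphs.
Variables (V : finType) (S : signed_graph V).

Definition positive_cycle (c : seq V) : bool :=
  ~~ odd (count (fun x => neg S x (next c x)) c).

Definition balanced : Prop :=
  forall c, is_cycle (underlying S) c -> positive_cycle c.

Definition unbalanced : Prop := ~ balanced.

End SignedGraphs.

Local Open Scope ring_scope.

Definition adjmx (R : nzRingType) (n : nat) (S : signed_graph 'I_n) : 'M[R]_n :=
  \matrix_(i, j) if adj (underlying S) i j then
                   if neg S i j then -1 else 1
                 else 0.

(* The (algebraic) multiplicity of 0 as an eigenvalue. *)
Definition eta (R : realFieldType) (n : nat) (S : signed_graph 'I_n) : nat :=
  mup 0 (char_poly (adjmx R S)).

(* Main.v *)
Require Import Defs.
From mathcomp Require Import all_boot all_order all_algebra.
From mathcomp Require Import zify ring lra.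

(* The adjacency matrix A is symmetric over a real field, so eta = n - rank A,
   and the point is that the ranks are exactly 6, ..., n.

   Rank at least 6: unless both cycles are squares, six vertices of oo(p,q,l)
   induce a subgraph with a unique perfect matching, hence with odd
   determinant.  If p = q = 4, the cycle space of G over F_2 has dimension
   |E| - |V| + 1 = 2 and is spanned by the two squares, so that one of them is
   negative; a negative square has rank 4, and a suitable further edge adds 2.

   Realization: a pendant path grown on oo(3,3,2) at an end of the joining edge
   keeps the matrix nonsingular, which gives every full rank >= 7; further
   pendant vertices at a vertex that already carries one leave the rank
   unchanged.  Rank 6 comes from oo(3,4,2) with balanced square, with pendant
   vertices attached at the vertex of the triangle on the joining edge. *)

Set Implicit Arguments.
Unset Strict Implicit.
Unset Printing Implicit Defensive.

Import Order.TTheory GRing.Theory Num.Theory.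

Local Open Scope ring_scope.

(** * The multiplicity of 0 for symmetric matrices *)

(** Both sides equal ['X^n * \det M] for the block matrix [M] below, whose two block eliminations
    produce the two characteristic polynomials. *)
Lemma char_poly_mulC (F : fieldType) (m n : nat) (L : 'M[F]_(m, n)) (K : 'M[F]_(n, m)) :
  'X^n * char_poly (L *m K) = 'X^m * char_poly (K *m L).
Proof.
rewrite /char_poly /char_poly_mx !map_mxM.
set L' := map_mx _ L; set K' := map_mx _ K.
pose M := block_mx ('X%:M : 'M[{poly F}]_m) L' K' 1%:M.
have eLK : \det M = \det ('X%:M - L' *m K').
  have: \det (M *m block_mx 1%:M 0 (- K') 1%:M) = \det M.
    by rewrite det_mulmx det_lblock !det1 !mulr1.
  move<-; rewrite mulmx_block !mulmx0 !mulmx1 !mul1mx mulmxN subrr !add0r.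
  by rewrite det_ublock det1 mulr1.
have: \det (block_mx 1%:M 0 (- K') 'X%:M *m M) = 'X^n * \det M.
  by rewrite det_mulmx det_lblock det1 mul1r det_scalar.
rewrite -eLK => <-; rewrite mulmx_block !mul0mx !mul1mx !addr0 mulmx1.
rewrite mulNmx mul_mx_scalar mul_scalar_mx addNr det_ublock det_scalar.
by rewrite mulNmx [- _ + _]addrC.
Qed.

Lemma row_sqr_eq0 (R : realFieldType) (n : nat) (u : 'rV[R]_n) :
  u *m u^T = 0 -> u = 0.
Proof.
move=> /matrixP/(_ 0 0); rewrite !mxE => h; apply/rowP=> j; rewrite mxE.
apply/eqP; rewrite -sqrf_eq0 expr2.
have := psumr_eq0P (P := xpredT) (F := fun j => u 0 j * u 0 j).
move=> -> //; first by move=> i _; rewrite -expr2 sqr_ge0.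
by apply: etrans h; apply: eq_bigr => i _; rewrite !mxE.
Qed.

(** With the rank factorization [A = L *m K], the characteristic polynomial is ['X^(n - r)] times
    that of the [r] by [r] matrix [K *m L], and this one is invertible. *)
Lemma mup0_char_poly_sym (R : realFieldType) (n : nat) (A : 'M[R]_n) :
  A^T = A -> mup 0 (char_poly A) = (n - \rank A)%N.
Proof.
move=> symA; set r := \rank A.
pose L := col_base A; pose K := row_base A.
have LK : L *m K = A by apply: mulmx_base.
(* Over a real field the row space of A meets its kernel trivially. *)
have uKL : K *m L \in unitmx.
  rewrite -row_free_unit; apply: inj_row_free => u uKL.
  have uA : u *m K *m A = 0.
    by apply: (etrans (congr1 _ (esym LK))); rewrite mulmxA -(mulmxA u) uKL mul0mx.
  have [w ew] : exists w, u *m K = w *m A.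
    by apply/submxP; apply: (submx_trans (submxMl _ _)); rewrite eq_row_base.
  have: u *m K = 0.
    apply: row_sqr_eq0.
    (* By symmetry the transpose of [w *m A] is [A *m w^T], and [u *m K *m A] is 0. *)
    by rewrite {2}ew trmx_mul symA mulmxA uA mul0mx.
  move/eqP; rewrite mulmx_free_eq0 ?row_base_free //.
  by move/eqP.
have := char_poly_mulC L K; rewrite LK => e.
have nr : (r <= n)%N by rewrite rank_leq_col.
have e2 : char_poly A = ('X - 0%:P) ^+ (n - r) * char_poly (K *m L).
  apply: (@mulfI _ 'X^r); first by rewrite -size_poly_eq0 size_polyXn.
  by rewrite e subr0 mulrA -exprD subnKC.
rewrite e2 mulrC mupMr ?mup_XsubCX ?eqxx //.
rewrite rootE horner_coef0 char_poly_det mulf_neq0 ?signr_eq0 //.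
by rewrite -unitfE -unitmxE.
Qed.

Lemma adjmx_sym (R : realFieldType) (n : nat) (S : signed_graph 'I_n) :
  (adjmx R S)^T = adjmx R S.
Proof. by apply/matrixP=> i j; rewrite !mxE adj_sym neg_sym. Qed.

Lemma eta_rank (R : realFieldType) (n : nat) (S : signed_graph 'I_n) :
  eta R S = (n - \rank (adjmx R S))%N.
Proof. by rewrite /eta mup0_char_poly_sym ?adjmx_sym. Qed.

(** * Six vertices that force rank 6 *)

(** A vanishing combination of the rows [g i] vanishes in particular at the columns [g j], so these
    rows are independent. *)
Lemma rank_principal_minor (F : fieldType) (m n : nat) (A : 'M[F]_n) (g : 'I_m -> 'I_n) :
  (forall u : 'I_m -> F, (forall j, \sum_i u i * A (g i) (g j) = 0) -> forall i, u i = 0) ->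
  (m <= \rank A)%N.
Proof.
move=> h; have: row_free (rowsub g A).
  apply: inj_row_free => u /rowP hu; apply/rowP=> i; rewrite mxE.
  apply: (h (u 0)) => j; have := hu (g j); rewrite !mxE; apply: etrans.
  by apply: eq_bigr => k _; rewrite !mxE.
by rewrite /row_free rowsubE => /eqP <-; apply: mxrankM_maxr.
Qed.

Lemma sum6_inord (R : pzRingType) (F : 'I_6 -> R) :
  \sum_i F i = F (inord 0) + F (inord 1) + F (inord 2) + F (inord 3) + F (inord 4)
               + F (inord 5).
Proof.
rewrite !big_ord_recr big_ord0 /= add0r.
by do !congr (_ + _); congr F; apply: val_inj; rewrite /= inordK.
Qed.

Lemma rank_principal6 (F : fieldType) (n : nat) (A : 'M[F]_n) (v0 v1 v2 v3 v4 v5 : 'I_n) :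
  (forall u0 u1 u2 u3 u4 u5,
   let s j := u0 * A v0 j + u1 * A v1 j + u2 * A v2 j + u3 * A v3 j
              + u4 * A v4 j + u5 * A v5 j in
   s v0 = 0 -> s v1 = 0 -> s v2 = 0 -> s v3 = 0 -> s v4 = 0 -> s v5 = 0 ->
   [/\ u0 = 0, u1 = 0, u2 = 0, u3 = 0 & u4 = 0 /\ u5 = 0]) ->
  (6 <= \rank A)%N.
Proof.
move=> h; pose v := [tuple v0; v1; v2; v3; v4; v5].
apply: (@rank_principal_minor _ _ _ _ (tnth v)) => u hu.
have e k : u (inord 0) * A v0 (tnth v k) + u (inord 1) * A v1 (tnth v k)
  + u (inord 2) * A v2 (tnth v k) + u (inord 3) * A v3 (tnth v k)
  + u (inord 4) * A v4 (tnth v k) + u (inord 5) * A v5 (tnth v k) = 0.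
  by rewrite -[RHS](hu k) sum6_inord !(tnth_nth v0) !inordK.
have ev j d : (j < 6)%N -> nth v0 v j = d -> tnth v (inord j) = d.
  by move=> lj <-; rewrite (tnth_nth v0) inordK.
have [] := h (u (inord 0)) (u (inord 1)) (u (inord 2)) (u (inord 3)) (u (inord 4))
  (u (inord 5)).
- by have := e (inord 0); rewrite (ev _ v0).
- by have := e (inord 1); rewrite (ev _ v1).
- by have := e (inord 2); rewrite (ev _ v2).
- by have := e (inord 3); rewrite (ev _ v3).
- by have := e (inord 4); rewrite (ev _ v4).
- by have := e (inord 5); rewrite (ev _ v5).
move=> h0 h1 h2 h3 [h4 h5] i; rewrite -(inord_val i).
by case: i => -[|[|[|[|[|[|]]]]]].
Qed.

Section Patterns.
Variables (R : realFieldType) (n : nat) (A : 'M[R]_n) (v0 v1 v2 v3 v4 v5 : 'I_n).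
Hypothesis symA : forall i j, A i j = A j i.
Hypothesis diagA : forall i, A i i = 0.
(** Entries in {0, 1, -1}, expressed as a polynomial identity that equational reasoning can use. *)
Hypothesis cubeA : forall i j, A i j * A i j * A i j = A i j.

(** The free entries confine the graph to two triangles v0v1v2 and v3v4v5 joined by v2v3.
    Eliminating along v0v1 and v4v5 leaves a system in [u2], [u3] with determinant 1 - 4t up to
    sign, where t is the product of the entries of both triangles. *)
Lemma rank_matching :
  [/\ A v0 v1 != 0, A v2 v3 != 0 & A v4 v5 != 0] ->
  [/\ A v0 v3 = 0, A v1 v3 = 0, A v0 v4 = 0 & A v0 v5 = 0] ->
  [/\ A v1 v4 = 0, A v1 v5 = 0, A v2 v4 = 0 & A v2 v5 = 0] ->
  (6 <= \rank A)%N.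
Proof.
move=> [n01 n23 n45] [z03 z13 z04 z05] [z14 z15 z24 z25].
have sqrA i j : A i j != 0 -> A i j * A i j = 1.
  by move=> nz; apply: (mulIf nz); rewrite cubeA mul1r.
have [e01 e23 e45] := And3 (sqrA _ _ n01) (sqrA _ _ n23) (sqrA _ _ n45).
have [c02 c12] := (cubeA v0 v2, cubeA v1 v2).
have [c34 c35] := (cubeA v3 v4, cubeA v3 v5).
apply: (@rank_principal6 _ _ _ v0 v1 v2 v3 v4 v5) => u0 u1 u2 u3 u4 u5 /=.
rewrite (symA v1 v0) (symA v2 v0) (symA v2 v1) (symA v3 v2) (symA v4 v3).
rewrite (symA v5 v3) (symA v5 v4) (symA v3 v0) (symA v3 v1) (symA v4 v0).
rewrite (symA v5 v0) (symA v4 v1) (symA v5 v1) (symA v4 v2) (symA v5 v2).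
rewrite !diagA z03 z13 z04 z05 z14 z15 z24 z25 !mulr0 !(add0r, addr0).
move: (A v0 v1) (A v2 v3) (A v4 v5) (A v0 v2) (A v1 v2) (A v3 v4) (A v3 v5)
  e01 e23 e45 c02 c12 c34 c35 => ab cu xy ac bc ux uy.
move=> e01 e23 e45 c02 c12 c34 c35 h0 h1 h2 h3 h4 h5.
(* A nonzero entry is its own inverse, so multiplying an equation by it isolates a variable. *)
have r1 : u1 = - (ab * ac * u2).
  by rewrite -[LHS]mulr1 -e01; transitivity (ab * (u1 * ab + u2 * ac) - ab * ac * u2);
    [ring|rewrite h0; ring].
have r0 : u0 = - (ab * bc * u2).
  by rewrite -[LHS]mulr1 -e01; transitivity (ab * (u0 * ab + u2 * bc) - ab * bc * u2);
    [ring|rewrite h1; ring].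
have r5 : u5 = - (xy * ux * u3).
  by rewrite -[LHS]mulr1 -e45; transitivity (xy * (u3 * ux + u5 * xy) - xy * ux * u3);
    [ring|rewrite h4; ring].
have r4 : u4 = - (xy * uy * u3).
  by rewrite -[LHS]mulr1 -e45; transitivity (xy * (u3 * uy + u4 * xy) - xy * uy * u3);
    [ring|rewrite h5; ring].
have r3 : u3 = 2 * (cu * ab * ac * bc) * u2.
  rewrite -[LHS]mulr1 -[in LHS]e23;
    transitivity (cu * (u0 * ac + u1 * bc + u3 * cu) - cu * (u0 * ac + u1 * bc));
    first by ring.
  by rewrite h2 r0 r1; ring.
have r2 : u2 = 2 * (cu * xy * ux * uy) * u3.
  rewrite -[LHS]mulr1 -[in LHS]e23;
    transitivity (cu * (u2 * cu + u4 * ux + u5 * uy) - cu * (u4 * ux + u5 * uy));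
    first by ring.
  by rewrite h3 r4 r5; ring.
pose t := ab * ac * bc * (xy * ux * uy).
have ct : t * t * t = t.
  transitivity ((ab * ab) * ab * (ac * ac * ac) * (bc * bc * bc)
    * ((xy * xy) * xy * (ux * ux * ux) * (uy * uy * uy))).
    by rewrite /t; ring.
  by rewrite e01 e45 c02 c12 c34 c35 /t; ring.
have q : u2 = 4 * (t * u2).
  transitivity (4 * (t * u2) * (cu * cu)); last by rewrite e23 mulr1.
  by rewrite {1}r2 {1}r3 /t; ring.
(* As t is 0, 1 or -1, the factor 1 - 4 t does not vanish. *)
clearbody t; have z2 : u2 = 0.
  have q1 : t * (t * u2) = 4 * (t * (t * (t * u2))) by rewrite {1}q; ring.
  have q2 : t * (t * (t * u2)) = t * u2 by rewrite !mulrA ct.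
  have q3 : t * u2 = 4 * (t * (t * u2)) by rewrite {1}q; ring.
  lra.
have z3 : u3 = 0 by rewrite r3 z2 mulr0.
by rewrite r0 r1 r4 r5 z2 z3 !mulr0 oppr0.
Qed.

(** Among the six vertices v5 sees only v4, whence [u4 = 0]. The square then splits into systems for
    [u1], [u3] and for [u0], [u2], both of determinant [a * c - b * d]; this would vanish for a
    positive square, and is [- 2 * (b * d)] for a negative one. *)
Lemma rank_negative_square :
  A v0 v1 * A v1 v2 * A v2 v3 * A v0 v3 = -1 ->
  A v4 v5 != 0 ->
  [/\ A v0 v2 = 0, A v1 v3 = 0, A v0 v4 = 0 & A v0 v5 = 0] ->
  [/\ A v1 v4 = 0, A v1 v5 = 0, A v2 v4 = 0, A v2 v5 = 0 & A v3 v5 = 0] ->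
  (6 <= \rank A)%N.
Proof.
move=> neg n45 [z02 z13 z04 z05] [z14 z15 z24 z25 z35].
have sqrA i j : A i j != 0 -> A i j * A i j = 1.
  by move=> nz; apply: (mulIf nz); rewrite cubeA mul1r.
have: A v0 v1 * A v1 v2 * A v2 v3 * A v0 v3 != 0 by rewrite neg oppr_eq0 oner_eq0.
rewrite !mulf_eq0 !negb_or -!andbA => /and4P[/sqrA e01 /sqrA e12 /sqrA e23 /sqrA e03].
have e45 := sqrA _ _ n45.
apply: (@rank_principal6 _ _ _ v0 v1 v2 v3 v4 v5) => u0 u1 u2 u3 u4 u5 /=.
rewrite (symA v1 v0) (symA v2 v0) (symA v2 v1) (symA v3 v2) (symA v4 v3).
rewrite (symA v5 v3) (symA v5 v4) (symA v3 v0) (symA v3 v1) (symA v4 v0).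
rewrite (symA v5 v0) (symA v4 v1) (symA v5 v1) (symA v4 v2) (symA v5 v2).
rewrite !diagA z02 z13 z04 z05 z14 z15 z24 z25 z35 !mulr0 !(add0r, addr0).
move: (A v0 v1) (A v1 v2) (A v2 v3) (A v0 v3) (A v4 v5) (A v3 v4)
  neg e01 e12 e23 e03 e45 => a b c d xy t neg ea eb ec ed exy h0 h1 h2 h3 h4 h5.
have z4 : u4 = 0 by rewrite -[LHS]mulr1 -exy mulrA h5 mul0r.
have eac : a * c = - (b * d).
  transitivity (a * b * c * d * (b * d)); last by rewrite neg mulN1r.
  by transitivity (a * c * (b * b) * (d * d)); [rewrite eb ed !mulr1|ring].
have bd0 u : u * (b * d) = 0 -> u = 0.
  move=> u0'; transitivity (u * (b * b) * (d * d)); first by rewrite eb ed !mulr1.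
  by transitivity (u * (b * d) * (b * d)); [ring|rewrite u0' mul0r].
have z3 : u3 = 0.
  apply: bd0; have : b * (u1 * a + u3 * d) - a * (u1 * b + u3 * c) = 0.
    by rewrite h0 h2 !mulr0 subr0.
  have -> : b * (u1 * a + u3 * d) - a * (u1 * b + u3 * c) = u3 * (b * d) - u3 * (a * c).
    by ring.
  by rewrite eac; lra.
have z2 : u2 = 0.
  apply: bd0; have : d * (u0 * a + u2 * b) - a * (u0 * d + u2 * c + u4 * t) = 0.
    by rewrite h1 h3 !mulr0 subr0.
  rewrite z4.
  have -> : d * (u0 * a + u2 * b) - a * (u0 * d + u2 * c + 0 * t)
      = u2 * (b * d) - u2 * (a * c) by ring.
  by rewrite eac; lra.
have z1 : u1 = 0 by rewrite -[LHS]mulr1 -ea mulrA; move: h0; rewrite z3 mul0r addr0 => ->;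
  rewrite mul0r.
have z0 : u0 = 0 by rewrite -[LHS]mulr1 -ea mulrA; move: h1; rewrite z2 mul0r addr0 => ->;
  rewrite mul0r.
have z5 : u5 = 0 by rewrite -[LHS]mulr1 -exy mulrA; move: h4; rewrite z3 mul0r add0r => ->;
  rewrite mul0r.
by [].
Qed.
End Patterns.

(** * The cycle space over F_2 *)

(** By the length bound on cycles, no cycle turns back along an edge; this also keeps vertices of
    degree one off cycles. *)
Lemma next_next_neq (V : finType) (G : sgraph V) (c : seq V) (x : V) :
  is_cycle G c -> x \in c -> next c (next c x) != x.
Proof.
case/and3P=> _ uc sc xc; have [i c' ec] := rot_to xc.
have := uc; have := sc; rewrite -!(next_rot i uc) -(rot_uniq i) -(size_rot i) ec.
case: c' {ec} => [|y [|z t]] //= _ /and3P[]; rewrite !inE !negb_or eqxx.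
by case/and3P=> /negPf xy xz _ _ _; rewrite [y == x]eq_sym xy eqxx eq_sym.
Qed.

Section CycleSpace.
Variables (n : nat) (S : signed_graph 'I_n).
Let G := underlying S.
Let edge (k : 'I_#|edges G|) : {set 'I_n} := enum_val k.
(** The unoriented incidence matrix: right multiplication by it is the boundary map from edge chains
    to vertex chains. *)
Let D : 'M['F_2]_(#|edges G|, n) := \matrix_(k, v) (v \in edge k)%:R.
Let chain (c : seq 'I_n) : 'rV['F_2]_#|edges G| :=
  \row_k \sum_(x <- c) ([set x; next c x] == edge k)%:R.

Lemma mem_edges (x y : 'I_n) : adj G x y -> [set x; y] \in edges G.
Proof. by move=> xy; apply/imsetP; exists (x, y); rewrite ?inE. Qed.

Lemma cycle_next_adj (c : seq 'I_n) (x : 'I_n) :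
  is_cycle G c -> x \in c -> adj G x (next c x).
Proof. by case/and3P=> cc _ _; apply: next_cycle. Qed.

(** Evaluates a linear functional at a cycle; the boundary at a vertex and the sign are both of this
    kind. *)
Lemma chain_sum (c : seq 'I_n) (F : {set 'I_n} -> 'F_2) : is_cycle G c ->
  \sum_k chain c 0 k * F (edge k) = \sum_(x <- c) F [set x; next c x].
Proof.
move=> cyc; under eq_bigr => k _ do rewrite mxE mulr_suml.
rewrite exchange_big big_seq [RHS]big_seq; apply: eq_bigr => x xc.
pose H e := ([set x; next c x] == e)%:R * F e.
rewrite (eq_bigr (fun k => H (enum_val k))) // -big_enum_val.
rewrite (bigD1 [set x; next c x]) /=; last by apply/mem_edges/cycle_next_adj.
rewrite /H eqxx mul1r big1 ?addr0 // => e /andP[_ /negPf].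
by rewrite eq_sym => ->; rewrite mul0r.
Qed.

Lemma perm_next (c : seq 'I_n) : uniq c -> perm_eq (map (next c) c) c.
Proof.
move=> uc; have ui : uniq (map (next c) c).
  by rewrite map_inj_uniq //; apply: can_inj (prev_next uc).
apply: uniq_perm => //.
have [] // := uniq_min_size ui _ _ (s2 := c); last by rewrite size_map.
by move=> _ /mapP[x xc ->]; rewrite mem_next.
Qed.

(** Each vertex of the cycle is met once as [x] and once as a successor, and 2 = 0. *)
Lemma chain_boundary (c : seq 'I_n) : is_cycle G c -> chain c *m D = 0.
Proof.
move=> cyc; apply/rowP=> v; rewrite [LHS]mxE [RHS]mxE.
under eq_bigr => k _ do rewrite [D _ _]mxE.
rewrite (chain_sum (fun e => (v \in e)%:R)) //.
have uc : uniq c by case/and3P: cyc.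
transitivity (\sum_(x <- c) ((v == x)%:R + (v == next c x)%:R) : 'F_2).
  rewrite big_seq [RHS]big_seq; apply: eq_bigr => x xc; rewrite !inE.
  have [->|] := eqVneq v x; last by rewrite add0r.
  suff /negPf-> : x != next c x by rewrite addr0.
  apply/eqP=> e; have := cycle_next_adj cyc xc.
  by rewrite -e adj_irr.
rewrite big_split /= -[X in _ + X](big_map (next c) xpredT (fun y => (v == y)%:R)).
rewrite (perm_big _ (perm_next uc)) /= -mulr2n -mulr_natr.
by rewrite (_ : 2%:R = 0 :> 'F_2) ?mulr0 //; apply/val_inj.
Qed.

(** A vector killed by [D^T] takes equal values at adjacent vertices, hence is constant by
    connectedness. *)
Lemma rank_boundary : connected_on G [set: 'I_n] -> (n.-1 <= \rank D)%N.
Proof.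
move=> [_ conn]; rewrite -mxrank_tr.
suff : (\rank (kermx D^T) <= 1)%N by rewrite mxrank_ker; move: (\rank _) => r; lia.
apply: leq_trans (rank_leq_row (const_mx 1 : 'rV['F_2]_n)).
apply: mxrankS; apply/row_subP=> i; set th := row i _.
have thD : th *m D^T = 0 by apply/sub_kermxP; apply: row_sub.
have thE x y : adj G x y -> th 0 x = th 0 y.
  move=> xy; have xye := mem_edges xy.
  have /rowP/(_ (enum_rank_in xye [set x; y])) := thD.
  rewrite [LHS]mxE [RHS]mxE.
  under eq_bigr => k _ do rewrite [_^T _ _]mxE [D _ _]mxE /edge enum_rankK_in //.
  have nxy : x != y by apply/eqP=> e; move: xy; rewrite e adj_irr.
  rewrite (bigD1 x) //= (bigD1 y) 1?eq_sym //= big1; last first.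
    move=> k /andP[/negPf kx /negPf ky].
    by rewrite !inE kx ky mulr0.
  rewrite !inE !eqxx orbT !mulr1 addr0 => /eqP.
  by rewrite addr_eq0 => /eqP->; rewrite oppr_pchar2 //; apply: pchar_Fp.
suff -> : th = th 0 i *: const_mx 1 by apply: scalemx_sub.
apply/rowP=> y; rewrite [RHS]mxE [X in _ * X]mxE mulr1.
have /connectP[p] := conn i y (in_setT _) (in_setT _).
move: (th 0) thE => f fE {th thD}.
elim: p i => [i _ -> //|z p IHp i /= /andP[/and3P[_ _ iz] pz] ey].
by rewrite (fE _ _ iz) (IHp z).
Qed.

(** The edge could be counted a second time only if traversed backwards, which [next_next_neq]
    excludes. *)
Lemma chain_diag (c : seq 'I_n) (x : 'I_n) (k : 'I_#|edges G|) :
  is_cycle G c -> x \in c -> edge k = [set x; next c x] -> chain c 0 k = 1.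
Proof.
move=> cyc xc ek; rewrite mxE ek; have uc : uniq c by case/and3P: cyc.
rewrite (bigD1_seq x) //= eqxx big_seq_cond big1 ?addr0 // => y /andP[yc yx].
case: eqP => // e.
have : y \in [set x; next c x] by rewrite -e set21.
have : x \in [set y; next c y] by rewrite e set21.
rewrite !inE (negPf yx) eq_sym (negPf yx) /= => /eqP ex /eqP ey.
by have := next_next_neq cyc yc; rewrite -ex -ey eqxx.
Qed.

Lemma chain_off (c : seq 'I_n) (x y : 'I_n) (k : 'I_#|edges G|) :
  x \notin c -> edge k = [set x; y] -> chain c 0 k = 0.
Proof.
move=> xc ek; rewrite mxE big_seq big1 // => z zc; rewrite ek.
case: eqP => // /setP/(_ x); rewrite !inE eqxx /=.
by case: eqP => [e|_ /eqP e]; move: xc; [rewrite e zc|rewrite e mem_next zc].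
Qed.

(** Counting negative edges mod 2 is linear on chains, so positivity passes to combinations of
    cycles. *)
Lemma chain_sign (c : seq 'I_n) : is_cycle G c ->
  \sum_k chain c 0 k *
    [exists x, exists y, (edge k == [set x; y]) && neg S x y]%:R = 0 <->
  positive_cycle S c.
Proof.
move=> cyc.
rewrite (chain_sum (fun e => [exists x, exists y, (e == [set x; y]) && neg S x y]%:R)) //.
have -> : \sum_(x <- c) [exists x0, exists y, ([set x; next c x] == [set x0;
  y]) && neg S x0 y]%:R
   = (count (fun x => neg S x (next c x)) c)%:R :> 'F_2.
  rewrite -sum1_count natr_sum [RHS]big_mkcond /=; apply: eq_bigr => x _.
  set b := [exists x0, _]; suff -> : b = neg S x (next c x) by case: neg.
  apply/existsP/idP => [[a /existsP[d /andP[/eqP e nad]]]|h]; last first.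
    by exists x; apply/existsP; exists (next c x); rewrite eqxx.
  have irr z : neg S z z = false by apply/negP=> /neg_adj; rewrite adj_irr.
  have : a \in [set x; next c x] by rewrite e set21.
  have : d \in [set x; next c x] by rewrite e set22.
  rewrite !inE; move: nad => /[swap] /orP[]/eqP-> /[swap] /orP[]/eqP->; rewrite ?irr //.
  by rewrite neg_sym.
rewrite /positive_cycle; set m := count _ _.
have key : (m%:R == 0 :> 'F_2) = ~~ odd m.
  by rewrite -(dvdn_pcharf (pchar_Fp (isT : prime 2))) dvdn2.
by split=> [/eqP|h]; [|apply/eqP]; rewrite key.
Qed.

(** Disjoint cycles have independent chains, as each has an edge outside the other. The cycle space
    has dimension at most 2, so they span it, and the sign functional vanishes on it. *)
Lemma balanced_two_cycles (c1 c2 : seq 'I_n) :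
  bicyclic G -> is_cycle G c1 -> is_cycle G c2 -> ~~ has [in c1] c2 ->
  positive_cycle S c1 -> positive_cycle S c2 -> balanced S.
Proof.
move=> [conn cardE] cyc1 cyc2 dis /(chain_sign cyc1) p1 /(chain_sign cyc2) p2 c cyc.
apply/(chain_sign cyc).
have [x1 x1c] : exists x, x \in c1 by case: (c1) cyc1 => [|x s] // _; exists x;
  apply: mem_head.
have [x2 x2c] : exists x, x \in c2 by case: (c2) cyc2 => [|x s] // _; exists x;
  apply: mem_head.
have x12 : x1 \notin c2 by apply: contra dis => h; apply/hasP; exists x1.
have x21 : x2 \notin c1 by apply: contra dis => h; apply/hasP; exists x2.
have [k1 ek1] : exists k, edge k = [set x1; next c1 x1].
  have h := mem_edges (cycle_next_adj cyc1 x1c).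
  by exists (enum_rank_in h [set x1; next c1 x1]); rewrite /edge enum_rankK_in.
have [k2 ek2] : exists k, edge k = [set x2; next c2 x2].
  have h := mem_edges (cycle_next_adj cyc2 x2c).
  by exists (enum_rank_in h [set x2; next c2 x2]); rewrite /edge enum_rankK_in.
pose W := col_mx (chain c1) (chain c2).
have WE (u : 'rV_(1 + 1)) : exists a b, u *m W = a *: chain c1 + b *: chain c2
    /\ (a = 0 -> b = 0 -> u = 0).
  exists (lsubmx u 0 0), (rsubmx u 0 0).
  have eu : u = row_mx (lsubmx u 0 0)%:M (rsubmx u 0 0)%:M.
    by rewrite -!mx11_scalar hsubmxK.
  split; first by rewrite {1}eu mul_row_col !mul_scalar_mx.
  by move=> a0 b0; rewrite eu a0 b0 !raddf0 row_mx0.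
have rW : \rank W = 2.
  apply/eqP; apply: inj_row_free => u uW.
  have [a [b [eu]]] := WE u; apply; move: eu; rewrite uW => /esym/rowP eu.
    have := eu k1; rewrite [LHS]mxE [X in X + _]mxE [X in _ + X]mxE [RHS]mxE.
    by rewrite (chain_diag cyc1 x1c ek1) (chain_off x12 ek1) mulr1 mulr0 addr0.
  have := eu k2; rewrite [LHS]mxE [X in X + _]mxE [X in _ + X]mxE [RHS]mxE.
  by rewrite (chain_diag cyc2 x2c ek2) (chain_off x21 ek2) mulr1 mulr0 add0r.
have WD : (W <= kermx D)%MS.
  by rewrite col_mx_sub; apply/andP; split; apply/sub_kermxP; apply: chain_boundary.
have DW : (kermx D <= W)%MS.
  rewrite -(mxrank_leqif_sup WD) rW mxrank_ker.
  have := mxrankS WD; rewrite rW mxrank_ker.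
  have := rank_boundary conn; have := cardE; rewrite card_ord.
  move: (\rank D) => r; move: #|edges G| => m; lia.
have /submxP[u] : (chain c <= W)%MS.
  by apply: submx_trans DW; apply/sub_kermxP; apply: chain_boundary.
have [a [b [-> _]]] := WE u; move=> ->.
under eq_bigr => k _ do rewrite mxE [X in X + _]mxE [X in _ + X]mxE mulrDl -!mulrA.
by rewrite big_split /= -!mulr_sumr p1 p2 !mulr0 addr0.
Qed.
End CycleSpace.

(** * The lower bound on the rank *)

(* For i < j: the labels form a path 0, ..., p+q+l-3, to which the two cycles
   add the closing chords {0, p-1} and {p+l-2, p+q+l-3}. *)
Local Notation infty_edge p q l i j :=
  [|| j == i.+1, (i == 0)%N && (j == p - 1)%N
    | (i == p + l - 2)%N && (j == p + q + l - 3)%N].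

Lemma infty_graph_embedding (V : finType) (G : sgraph V) (p q l : nat) :
  (2 < p)%N -> (2 < q)%N -> (1 < l)%N -> attach_trees (infty_graph p q l) G ->
  exists g : nat -> V, forall i j, (i < j < p + q + l - 2)%N ->
    g i != g j /\
    adj G (g i) (g j) = infty_edge p q l i j.
Proof.
move=> hp hq hl [f [r [fK _ adjE]]].
have N0 : (0 < p + q + l - 2)%N by lia.
(* Labels out of range go to 0, so that [g] is total on [nat] and index arithmetic is left to
   [lia]. *)
pose h i := insubd (Ordinal N0) i; exists (fun i => f (h i)) => i j ij.
have hi : h i = i :> nat by rewrite val_insubd; case: ltnP => //; lia.
have hj : h j = j :> nat by rewrite val_insubd; case: ltnP => //; lia.
have nij : h i != h j by rewrite -val_eqE /= hi hj; lia.
split; first by rewrite (can_eq fK).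
rewrite adjE ?fK // !eqxx; move: (h i) (h j) hi hj nij => a b ea eb nab.
rewrite /= /adj_of_rel /= nab /cycle_edge /path_edge /= ea eb {a b ea eb nab}.
have [ij1 jN] := andP ij.
have -> : (i == j.+1) = false by lia.
have -> : (j == 0)%N = false by lia.
have -> : (j == p + l - 2)%N && (i == p + q + l - 3)%N = false by lia.
rewrite !andbF !orbF; case: eqP => [e|_]; last by rewrite !andbF.
rewrite /= !andbT.
have [|] := leqP j (p - 1)%N; first by rewrite orTb.
have [|] := leqP j (p + l - 2)%N => hj1 hj2.
  by rewrite (_ : (p - 1 <= i)%N) ?orbT //; lia.
have -> : (p + l - 2 <= i)%N by lia.
have -> : (j <= p + q + l - 3)%N by lia.
by rewrite ?orbT.
Qed.

Section AdjacencyEntries.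
Variables (R : realFieldType) (n : nat) (S : signed_graph 'I_n).
Let A := adjmx R S.

Lemma adjmx_eq0 (i j : 'I_n) : (A i j == 0) = ~~ adj (underlying S) i j.
Proof.
rewrite mxE; case: adj; last by rewrite eqxx.
by case: neg; rewrite ?oppr_eq0 oner_eq0.
Qed.

Lemma adjmxC (i j : 'I_n) : A i j = A j i.
Proof. by rewrite !mxE adj_sym neg_sym. Qed.

Lemma adjmx_diag (i : 'I_n) : A i i = 0.
Proof. by apply/eqP; rewrite adjmx_eq0 adj_irr. Qed.

Lemma adjmx_cube (i j : 'I_n) : A i j * A i j * A i j = A i j.
Proof.
by rewrite !mxE; case: adj; [case: neg|]; rewrite ?(mulrNN, mulr1, mul1r, mulr0).
Qed.

(** Translates the sign of a square into the product of entries that [rank_negative_square]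
    expects. *)
Lemma square_positive (a b c d : 'I_n) :
  uniq [:: a; b; c; d] ->
  [&& adj (underlying S) a b, adj (underlying S) b c,
      adj (underlying S) c d & adj (underlying S) a d] ->
  is_cycle (underlying S) [:: a; b; c; d] /\
  (~~ positive_cycle S [:: a; b; c; d] -> A a b * A b c * A c d * A a d = -1).
Proof.
move=> u /and4P[ab bc cd ad]; split.
  by rewrite /is_cycle u /= ab bc cd adj_sym ad.
rewrite /positive_cycle /= addn0 negbK !mxE ab bc cd ad.
move: u => /=; rewrite !inE !negb_or => /and4P[/and3P[nab nac nad] /andP[nbc nbd] ncd _].
rewrite !eqxx ![b == a]eq_sym ![c == a]eq_sym ![d == a]eq_sym ![c == b]eq_sym
  ![d == b]eq_sym ![d == c]eq_sym.
rewrite (negPf nab) (negPf nac) (negPf nad) (negPf nbc) (negPf nbd) (negPf ncd)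
  (neg_sym S d a).
by do 4 case: neg => //=; rewrite ?(mulr1, mulN1r, opprK, mulrN1).
Qed.
End AdjacencyEntries.

Lemma rank_adjmx_ge6 (R : realFieldType) (n : nat) (S : signed_graph 'I_n) :
  Bplus (underlying S) -> unbalanced S -> (6 <= \rank (adjmx R S))%N.
Proof.
move=> [bic [p [q [l [hp hq hl emb]]]]] unb.
have [g gE] := infty_graph_embedding hp hq hl emb.
have adjg i j : (i < j < p + q + l - 2)%N ->
    adj (underlying S) (g i) (g j) = infty_edge p q l i j.
  by move=> /gE[].
set A := adjmx R S.
have A1 i j : (i < j < p + q + l - 2)%N ->
  infty_edge p q l i j -> A (g i) (g j) != 0.
  by move=> ij; rewrite adjmx_eq0 negbK adjg.
have A0 i j : (i < j < p + q + l - 2)%N ->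
  infty_edge p q l i j = false -> A (g i) (g j) = 0.
  by move=> ij e; apply/eqP; rewrite adjmx_eq0 adjg // e.
have C := adjmxC R S; have dg := adjmx_diag R S; have cb := adjmx_cube R S.
have A0' i j : (i < j < p + q + l - 2)%N ->
  infty_edge p q l i j = false -> A (g j) (g i) = 0.
  by move=> ij e; rewrite C; apply: A0.
have A1' i j : (i < j < p + q + l - 2)%N ->
  infty_edge p q l i j -> A (g j) (g i) != 0.
  by move=> ij e; rewrite C; apply: A1.
(* Six vertices with edges v0v1, v2v3, v4v5 as their only perfect matching;
   they exist unless both cycles are squares. *)
have [p3|p3] := eqVneq p 3.
  (* The triangle 0, 1, 2, the next vertex 3, and an edge of C_q that misses its joint [l + 1]. *)
  apply: (@rank_matching _ _ _ (g 0) (g 1) (g 2) (g 3) (g (l + 2)) (g (l + 3))) => //;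
    split;
   by [apply: A1; lia | apply: A0; lia].
have [q3|q3] := eqVneq q 3.
  (* The mirror image: [d] is the joint of C_q, and 0, 1 is an edge of C_p that misses the joint
     [p - 1], since now p is at least 4. *)
  pose d := (p + l - 2)%N.
  apply: (@rank_matching _ _ _ (g d.+2) (g d.+1) (g d) (g d.-1) (g 0) (g 1)) => //; split;
   by [apply: A1'; lia | apply: A0'; lia | apply: A1; lia].
have [p5|p5] := leqP 5 p.
  (* Four consecutive vertices of C_p, whose ends 0 and 3 are not adjacent as p is at least 5, and
     an edge of C_q off its joint. *)
  pose d := (p + l - 2)%N.
  apply: (@rank_matching _ _ _ (g 0) (g 1) (g 2) (g 3) (g d.+1) (g d.+2)) => //; split;
   by [apply: A1; lia | apply: A0; lia].
have [q5|q5] := leqP 5 q.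
  pose d := (p + l - 2)%N.
  apply: (@rank_matching _ _ _ (g d.+1) (g d.+2) (g d.+3) (g d.+4) (g 0) (g 1)) => //;
    split;
   by [apply: A1; lia | apply: A0; lia | apply: A0'; lia].
have {p3 p5} p4 : p = 4 by lia.
have {q3 q5} q4 : q = 4 by lia.
subst p q.
have gU i j : (i < j < 4 + 4 + l - 2)%N -> g i == g j = false by move=> /gE[/negPf].
have [||cyc1 sg1] := @square_positive R _ S (g 0) (g 1) (g 2) (g 3).
- by rewrite /= !inE !gU //; lia.
- by rewrite !adjg //; lia.
have [||cyc2 sg2] := @square_positive R _ S (g (l + 2)) (g (l + 3)) (g (l + 4)) (g (l + 5)).
- by rewrite /= !inE !gU //; lia.
- by rewrite !adjg //; lia.
have [p1|n1] := boolP (positive_cycle S [:: g 0; g 1; g 2; g 3]); last first.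
  (* The joints are 3 and [l + 2]. They are adjacent exactly when l = 2, whence the free entry v3v4
     in the lemma. *)
  apply: (@rank_negative_square _ _ _ (g 0) (g 1) (g 2) (g 3) (g (l + 2)) (g (l + 3))) =>
    //.
  - exact: sg1.
  - by apply: A1; lia.
  - by split; apply: A0; lia.
  - by split; apply: A0; lia.
have [p2|n2] := boolP (positive_cycle S [:: g (l + 2); g (l + 3); g (l + 4); g (l + 5)]);
  last first.
  (* The square is rotated so that its joint [l + 2] comes last, as v3. *)
  apply: (@rank_negative_square _ _ _ (g (l + 3)) (g (l + 4)) (g (l + 5)) (g (l + 2)) (g 3)
    (g 2)) => //.
  - rewrite -(sg2 n2) (C (g (l + 5)%N)) (C (g (l + 3)%N) (g (l + 2)%N)); ring.
  - by apply: A1'; lia.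
  - by split; [apply: A0|apply: A0'|apply: A0'|apply: A0']; lia.
  - by split; apply: A0'; lia.
case: unb; apply: (balanced_two_cycles bic cyc1 cyc2 _ p1 p2).
by rewrite /= !inE ![g (l + _)%N == _]eq_sym !gU //; lia.
Qed.

(** * Attaching a pendant vertex to a graph *)

Lemma adj_in_sym (V : finType) (G : sgraph V) (A : {set V}) : symmetric (adj_in G A).
Proof. by move=> x y; rewrite /adj_in /= adj_sym andbCA. Qed.

Section Pendant.
Variable n : nat.

(** The new vertex is [ord0] and old labels are shifted by one. The flag [b] is true for adjacency
    and false for negative edges, so the new edge is positive. *)
Definition pendant_rel (e : rel 'I_n) (b : bool) (v : 'I_n) : rel 'I_n.+1 :=
  fun x y => match unlift ord0 x, unlift ord0 y with
    | Some i, Some j => e i j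
    | Some i, None => b && (i == v)
    | None, Some j => b && (j == v)
    | None, None => false
    end.

Lemma pendant_rel_lift e b v i j :
  pendant_rel e b v (lift ord0 i) (lift ord0 j) = e i j.
Proof. by rewrite /pendant_rel !liftK. Qed.

Lemma pendant_rel_0lift e b v j : pendant_rel e b v ord0 (lift ord0 j) = b && (j == v).
Proof. by rewrite /pendant_rel liftK unlift_none. Qed.

Lemma pendant_rel_00 e b v : pendant_rel e b v ord0 ord0 = false.
Proof. by rewrite /pendant_rel unlift_none. Qed.

Lemma pendant_rel_sym e b v : symmetric e -> symmetric (pendant_rel e b v).
Proof.
by move=> se x y; rewrite /pendant_rel; case: unlift => [i|]; case: unlift.
Qed.

Lemma pendant_rel_irr e b v : irreflexive e -> irreflexive (pendant_rel e b v).
Proof. by move=> ie x; rewrite /pendant_rel; case: unlift. Qed.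

Definition pendant_graph (G : sgraph 'I_n) (v : 'I_n) : sgraph 'I_n.+1 :=
  SGraph (pendant_rel_sym true v (@adj_sym _ G)) (pendant_rel_irr true v (@adj_irr _ G)).

Lemma pendant_neg_adj (S : signed_graph 'I_n) (v : 'I_n) :
  subrel (pendant_rel (neg S) false v) (adj (pendant_graph (underlying S) v)).
Proof.
by move=> x y; rewrite /= /pendant_rel; case: unlift => [i|];
  case: unlift => [j|] // /neg_adj.
Qed.

Definition pendant (S : signed_graph 'I_n) (v : 'I_n) : signed_graph 'I_n.+1 :=
  SignedGraph (pendant_rel_sym false v (@neg_sym _ S)) (@pendant_neg_adj S v).

Variables (G : sgraph 'I_n) (v : 'I_n).
Let G' := pendant_graph G v.

Definition pendant_proj (x : 'I_n.+1) : 'I_n := odflt v (unlift ord0 x).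

Lemma pendant_proj_lift i : pendant_proj (lift ord0 i) = i.
Proof. by rewrite /pendant_proj liftK. Qed.

Lemma pendant_proj0 : pendant_proj ord0 = v.
Proof. by rewrite /pendant_proj unlift_none. Qed.

Lemma adj_pendant0 x : adj G' ord0 x = (x == lift ord0 v).
Proof.
have [j ->|->] := unliftP ord0 x; last by rewrite /= pendant_rel_00 eq_liftF.
by rewrite /= pendant_rel_0lift (inj_eq lift_inj).
Qed.

(** Preimages under [pendant_proj] serve both the whole graph and the trees, of which only the one
    containing [v] grows. *)
Lemma pendant_connected (A : {set 'I_n}) :
  connected_on G A -> connected_on G' [set x | pendant_proj x \in A].
Proof.
case=> /set0Pn[a aA] conn; split.
  by apply/set0Pn; exists (lift ord0 a); rewrite inE pendant_proj_lift.
set A' := [set x | _].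
have cl i j : i \in A -> connect (adj_in G A) i j ->
    connect (adj_in G' A') (lift ord0 i) (lift ord0 j).
  move=> iA /connectP[p pth ->]; apply/connectP; exists (map (lift ord0) p);
    last by rewrite last_map.
  elim: p i iA pth => //= j' p IHp i iA /andP[/and3P[_ jA ij] pth].
  by rewrite IHp // andbT /adj_in /= !inE !pendant_proj_lift iA jA pendant_rel_lift.
have cp x : x \in A' -> connect (adj_in G' A') x (lift ord0 (pendant_proj x)).
  have [j ->|->] := unliftP ord0 x; first by rewrite pendant_proj_lift connect0.
  rewrite inE pendant_proj0 => vA; apply: connect1.
  by apply/and3P; split; rewrite ?inE ?pendant_proj0 ?pendant_proj_lift // adj_pendant0.
move=> x y xA yA; apply: connect_trans (cp x xA) _.
apply: (connect_trans (y := lift ord0 (pendant_proj y))).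
  by apply: cl; [|apply: conn]; move: xA yA; rewrite !inE.
by rewrite (sym_connect_sym (@adj_in_sym _ _ _)); apply: cp.
Qed.

Lemma map_lift_cycle (c : seq 'I_n) : is_cycle G' (map (lift ord0) c) = is_cycle G c.
Proof.
rewrite /is_cycle size_map (map_inj_uniq lift_inj) cycle_map.
by under eq_cycle => x y do rewrite /= pendant_rel_lift.
Qed.

Lemma pendant_cycle (c : seq 'I_n.+1) : is_cycle G' c ->
  exists2 c0, c = map (lift ord0) c0 & is_cycle G c0.
Proof.
move=> cyc; have /and3P[cc uc _] := cyc.
(* The neighbours of ord0 in a cycle would both be its only neighbour. *)
have c0 : ord0 \notin c.
  apply/negP=> h0.
  have pc : prev c ord0 \in c by rewrite mem_prev.
  have := next_next_neq cyc pc; rewrite (next_prev uc).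
  have := next_cycle cc h0; rewrite adj_pendant0 => /eqP->.
  by have := prev_cycle cc h0; rewrite adj_sym adj_pendant0 => /eqP->; rewrite eqxx.
have ec : c = map (lift ord0) (map pendant_proj c).
  rewrite -map_comp -[LHS]map_id; apply/eq_in_map => x xc /=.
  have [j ->|e] := unliftP ord0 x; first by rewrite pendant_proj_lift.
  by rewrite -e xc in c0.
by exists (map pendant_proj c); rewrite // -map_lift_cycle -ec.
Qed.

Lemma pendant_tree (A : {set 'I_n}) :
  tree_on G A -> tree_on G' [set x | pendant_proj x \in A].
Proof.
case=> conn acyc; split; first exact: pendant_connected.
move=> _ /pendant_cycle[c -> cyc]; apply: contra (acyc c cyc).
rewrite all_map; apply: sub_all => x /=; by rewrite inE pendant_proj_lift.
Qed.

(** The new vertex joins the tree containing [v], and the new edge lies inside that tree. *)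
Lemma pendant_attach_trees (W : finType) (H : sgraph W) :
  attach_trees H G -> attach_trees H G'.
Proof.
case=> f [r [fK trees adjE]]; exists (lift ord0 \o f), (r \o pendant_proj); split.
- by move=> w; rewrite /= pendant_proj_lift fK.
- move=> w; rewrite (_ : [set _ | _] = [set x | pendant_proj x \in [set x | r x == w]]).
    exact: pendant_tree.
  by apply/setP=> x; rewrite !inE.
move=> x y /=.
have [i ->|->] := unliftP ord0 x; have [j ->|->] := unliftP ord0 y;
  rewrite ?pendant_proj_lift ?pendant_proj0.
- by move=> rij; rewrite pendant_rel_lift !(inj_eq lift_inj) adjE.
- move=> riv; rewrite eq_liftF andbF (pendant_rel_sym _ _ (@adj_sym _ G)) pendant_rel_0lift.
  by apply/eqP=> e; rewrite e eqxx in riv.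
- move=> rvj; rewrite eq_liftF pendant_rel_0lift.
  by apply/eqP=> e; rewrite e eqxx in rvj.
- by rewrite eqxx.
Qed.

End Pendant.

(** Indexing edges by increasing pairs gives a sum that [big_ord_recl] can split off or compute. *)
Lemma card_edges (n : nat) (G : sgraph 'I_n) :
  #|edges G| = (\sum_(i < n) \sum_(j < n) ((i < j)%N && adj G i j))%N.
Proof.
pose B := [set x : 'I_n * 'I_n | (x.1 < x.2)%N && adj G x.1 x.2].
have -> : edges G = [set [set x.1; x.2] | x in B].
  apply/setP=> e; apply/imsetP/imsetP=> -[[x y]]; rewrite inE /=.
    move=> xy ->; have [lxy|lyx|exy] := ltngtP x y.
    - by exists (x, y); rewrite // inE /= lxy.
    - by exists (y, x); rewrite ?inE /= ?lyx 1?adj_sym // setUC.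
    - by move: xy; rewrite (val_inj exy) adj_irr.
  by case/andP=> _ xy ->; exists (x, y); rewrite ?inE.
rewrite card_in_imset => [|[x y] [z t]]; last first.
  rewrite !inE /= => /andP[xy _] /andP[zt _] e.
  have : x \in [set z; t] by rewrite -e set21.
  have : y \in [set z; t] by rewrite -e set22.
  rewrite !inE; move: xy => /[swap] /orP[]/eqP-> /[swap] /orP[]/eqP->; rewrite ?ltnn //.
  by rewrite ltnNge ltnW.
rewrite -sum1_card pair_big /= [LHS]big_mkcond; apply: eq_bigr => -[x y] _.
by rewrite inE /=; case: andP.
Qed.

Lemma pendant_bicyclic (n : nat) (G : sgraph 'I_n) (v : 'I_n) :
  bicyclic G -> bicyclic (pendant_graph G v).
Proof.
case=> conn; rewrite !card_ord => cE; split.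
  have := pendant_connected v conn; congr connected_on.
  by apply/setP=> x; rewrite !inE.
rewrite -[in RHS]cE !card_edges big_ord_recl big_ord_recl /= add0n -[RHS]add1n;
  congr (_ + _)%N.
  rewrite (bigD1 v) //= pendant_rel_0lift eqxx big1 // => j /negPf jv.
  by rewrite pendant_rel_0lift jv.
rewrite [RHS]card_ord; apply: eq_bigr => i _; rewrite big_ord_recl /= add0n.
by apply: eq_bigr => j _; rewrite pendant_rel_lift.
Qed.

Lemma pendant_Bplus (n : nat) (G : sgraph 'I_n) (v : 'I_n) :
  Bplus G -> Bplus (pendant_graph G v).
Proof.
case=> bic [p [q [l [hp hq hl att]]]]; split; first exact: pendant_bicyclic.
by exists p, q, l; split=> //; apply: pendant_attach_trees.
Qed.

Lemma pendant_unbalanced (n : nat) (S : signed_graph 'I_n) (v : 'I_n) :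
  unbalanced S -> unbalanced (pendant S v).
Proof.
move=> unb bal; apply: unb => c cyc.
have := bal (map (lift ord0) c); rewrite map_lift_cycle => /(_ cyc).
rewrite /positive_cycle count_map; congr (~~ odd _); apply: eq_count => x /=.
have /and3P[_ uc _] := cyc.
by rewrite (next_map lift_inj) // pendant_rel_lift.
Qed.

(** * The rank after attaching pendant vertices *)

Section PendantMatrix.
Variables (R : realFieldType) (n : nat).

Definition pendant_mx (A : 'M[R]_n) (v : 'I_n) : 'M[R]_(1 + n) :=
  block_mx 0 (delta_mx 0 v) (delta_mx v 0) A.

Section Entries.
Variables (A : 'M[R]_n) (v : 'I_n).

Lemma pendant_mx_lift (i j : 'I_n) :
  pendant_mx A v (lift ord0 i) (lift ord0 j) = A i j.
Proof. by rewrite -!rshift1 block_mxEdr. Qed.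

Lemma pendant_mx_0lift (j : 'I_n) : pendant_mx A v ord0 (lift ord0 j) = (j == v)%:R.
Proof. by rewrite -rshift1 -[ord0](@lshift0 n 0) block_mxEur mxE eqxx. Qed.

Lemma pendant_mx_lift0 (i : 'I_n) : pendant_mx A v (lift ord0 i) ord0 = (i == v)%:R.
Proof. by rewrite -rshift1 -[ord0](@lshift0 n 0) block_mxEdl mxE eqxx andbT. Qed.

Lemma pendant_mx_00 : pendant_mx A v ord0 ord0 = 0.
Proof. by rewrite -[ord0](@lshift0 n 0) block_mxEul mxE. Qed.
End Entries.

Lemma adjmx_pendant (S : signed_graph 'I_n) (v : 'I_n) :
  adjmx R (pendant S v) = pendant_mx (adjmx R S) v.
Proof.
have ifE (b : bool) : (if b then 1 else 0 : R) = b%:R by case: b.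
apply/matrixP=> i j; rewrite mxE /=.
have [i0 ->|->] := unliftP ord0 i; have [j0 ->|->] := unliftP ord0 j.
- by rewrite (pendant_mx_lift _ _ i0 j0) !pendant_rel_lift mxE.
- rewrite (pendant_mx_lift0 _ _ i0) (pendant_rel_sym _ _ (@adj_sym _ _)).
  by rewrite (pendant_rel_sym _ _ (@neg_sym _ _)) !pendant_rel_0lift ifE.
- by rewrite (pendant_mx_0lift _ _ j0) !pendant_rel_0lift ifE.
- by rewrite pendant_mx_00 pendant_rel_00.
Qed.

(** The bordered matrix is [B *m A *m B^T] with [B = col_mx y 1%:M]: the new row is the combination
    [y] of the rows of [A], and the corner is [y 0 v = 0]. *)
Lemma rank_pendant_twin (A : 'M[R]_n) (v : 'I_n) (y : 'rV[R]_n) :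
  A^T = A -> y *m A = delta_mx 0 v -> y 0 v = 0 -> \rank (pendant_mx A v) = \rank A.
Proof.
move=> symA yA yv.
have Ay : A *m y^T = delta_mx v 0 by rewrite -trmx_delta -yA trmx_mul symA.
apply/anti_leq/andP; split.
  have -> : pendant_mx A v = col_mx y 1%:M *m A *m row_mx y^T 1%:M.
    rewrite mul_col_mx yA mul1mx mul_col_row mulmx1 Ay mulmx1; congr block_mx.
    apply/matrixP=> i j; rewrite !ord1 [LHS]mxE mxE (bigD1 v) //= big1.
      by rewrite !mxE !eqxx yv mulr0 addr0.
    by move=> k /negPf kv; rewrite !mxE kv andbF mul0r.
  by apply: leq_trans (mxrankM_maxl _ _) (mxrankM_maxr _ _).
have {1}-> : A = row_mx 0 1%:M *m pendant_mx A v *m col_mx 0 1%:M.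
  by rewrite mul_row_block !mul0mx !mul1mx mul_row_col mulmx0 mulmx1 !add0r.
by apply: leq_trans (mxrankM_maxl _ _) (mxrankM_maxr _ _).
Qed.

(** Against the new column the extended witness gives [y 0 v], so this entry being 0 keeps the twin
    condition alive. *)
Lemma pendant_twin_witness (A : 'M[R]_n) (v : 'I_n) (y : 'rV[R]_n) :
  y *m A = delta_mx 0 v -> y 0 v = 0 ->
  row_mx 0 y *m pendant_mx A v = delta_mx 0 (lift ord0 v) /\
  (row_mx 0 y : 'rV_(1 + n)) 0 (lift ord0 v) = 0.
Proof.
move=> yA yv; rewrite -!rshift1 row_mxEr; split=> //.
rewrite mul_row_block !mul0mx !add0r yA -[RHS](@hsubmxK _ 1 1 n); congr row_mx.
  apply/matrixP=> i j; rewrite !ord1 [LHS]mxE (bigD1 v) //= big1.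
    by rewrite !mxE eqxx yv mul0r addr0 -val_eqE.
  by move=> k /negPf kv; rewrite !mxE kv mulr0.
by apply/matrixP=> i j; rewrite !mxE !ord1 !eqxx (inj_eq (@rshift_inj 1 n)).
Qed.
End PendantMatrix.

(** This grows a path of two edges at [v]. The column of its end vertex kills the coefficient of the
    middle one; then [A] kills the old coefficients, and the last one follows. *)
Lemma unitmx_double_pendant (R : realFieldType) (n : nat) (A : 'M[R]_n) (v : 'I_n) :
  A \in unitmx -> pendant_mx (pendant_mx A v) ord0 \in unitmx.
Proof.
move=> uA; rewrite -row_free_unit; apply: inj_row_free => u.
rewrite -[u]hsubmxK; move: (lsubmx u) (rsubmx u) => a w.
rewrite /pendant_mx mul_row_block -[RHS]row_mx0 => /eq_row_mx[].
rewrite mulmx0 add0r => w0.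
have {}w0 : lsubmx w = 0.
  move/matrixP/(_ 0 0): w0; rewrite [LHS]mxE (bigD1 ord0) //= big1.
    rewrite !mxE !eqxx mulr1 addr0 => w00; apply/matrixP=> i j.
    by rewrite !ord1 !mxE lshift0 w00.
  by move=> k /negPf k0; rewrite !mxE k0 mulr0.
rewrite -[w]hsubmxK w0 mul_row_block !mul0mx !add0r.
have -> : (delta_mx 0 ord0 : 'rV[R]_(1 + n)) = row_mx 1%:M 0.
  apply/rowP=> k; rewrite !mxE; case: splitP => j ek; rewrite !mxE.
    by rewrite ord1 eqxx (_ : k = ord0) ?eqxx //; apply/val_inj; rewrite ord1 in ek.
  have -> : (k == ord0) = false by apply/eqP => k0; move: ek; rewrite k0.
  by rewrite andbF.
rewrite mul_mx_row mulmx1 mulmx0 add_row_mx add0r -[RHS]row_mx0 => /eq_row_mx[ea].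
move/(congr1 (mulmx^~ (invmx A))); rewrite mulmxK // mul0mx => ew.
by move: ea; rewrite ew mul0mx addr0 => ->; rewrite !row_mx0.
Qed.

(** * The base graphs oo(3,q,2) *)

Lemma attach_trees_refl (V : finType) (H : sgraph V) : attach_trees H H.
Proof.
exists id, id; split=> // [w|x y _]; last by rewrite !eqxx.
have inw x : (x \in [set x | x == w]) = (x == w) by rewrite inE.
split; [split|].
- by apply/set0Pn; exists w; rewrite inw.
- by move=> x y; rewrite !inw => /eqP-> /eqP->; rewrite connect0.
move=> c /and3P[_ uc sc]; apply/negP=> /allP;
  case: c uc sc => [|x [|y c]] //= /andP[xc _] _ h.
have /eqP ex : x == w by rewrite -inw; apply: h; rewrite mem_head.
have /eqP ey : y == w by rewrite -inw; apply: h; rewrite !inE eqxx orbT.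
by rewrite ex ey mem_head in xc.
Qed.

Lemma connected_consecutive (n : nat) (G : sgraph 'I_n) : (0 < n)%N ->
  (forall i j : 'I_n, j = i.+1 :> nat -> adj G i j) -> connected_on G [set: 'I_n].
Proof.
move=> n0 adjS; split; first by apply/set0Pn; exists (Ordinal n0).
have c0 x : connect (adj_in G [set: 'I_n]) (Ordinal n0) x.
  case: x => m; elim: m => [|m IHm] lm; first by apply: eq_connect0; apply: val_inj.
  apply: connect_trans (IHm (ltnW lm)) _; apply: connect1.
  by rewrite /adj_in /= !inE; apply: adjS.
move=> x y _ _; apply: connect_trans (c0 y).
by rewrite (sym_connect_sym (@adj_in_sym _ _ _)).
Qed.

(* The edge {0, 1} of the triangle is the only negative one. *)
Section NegativeTriangle.
Variable q : nat.

Fact first_edge_sym : symmetric (fun x y : 'I_(3 + q + 2 - 2) => x + y == 1)%N.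
Proof. by move=> x y; rewrite addnC. Qed.

Fact first_edge_adj :
  subrel (fun x y : 'I_(3 + q + 2 - 2) => x + y == 1)%N (adj (infty_graph 3 q 2)).
Proof.
move=> [x lx] [y ly] /= xy; rewrite /adj_of_rel /= -val_eqE /=.
have [[-> ->]|[-> ->]] : x = 0%N /\ y = 1%N \/ x = 1%N /\ y = 0%N by lia.
- by [].
- by rewrite !orbT.
Qed.

Definition infty_neg : signed_graph 'I_(3 + q + 2 - 2) :=
  SignedGraph first_edge_sym first_edge_adj.

End NegativeTriangle.

Lemma infty_neg_unbalanced (q : nat) : unbalanced (infty_neg q.+3).
Proof.
have l k : (k < 3 -> k < 3 + q.+3 + 2 - 2)%N by lia.
pose t k (lk : (k < 3)%N) := Ordinal (l k lk).
(* The triangle has exactly one negative edge, and both facts about it hold by computation. *)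
by move/(_ [:: t 0 isT; t 1 isT; t 2 isT])%N/(_ isT).
Qed.

Lemma infty_connected (q : nat) : connected_on (infty_graph 3 q.+3 2) setT.
Proof.
apply: connected_consecutive => [|i j ij]; first by lia.
have lj := ltn_ord j; rewrite /= /adj_of_rel /= -val_eqE /= /cycle_edge /path_edge /=.
rewrite ij eqxx !andbT neq_ltn ltnSn /= in lj *.
have [//|i2] := ltnP i (3 - 1)%N; have [i3|i3] := ltnP i (3 + 2 - 2)%N.
  by rewrite !orbT.
by rewrite (_ : (i < 3 + q.+3 + 2 - 3)%N) ?orbT //; lia.
Qed.

Lemma infty33_bicyclic : @bicyclic 'I_6 (infty_graph 3 3 2).
Proof.
split; first exact (infty_connected 0).
by rewrite (@card_edges 6) card_ord !big_ord_recl !big_ord0.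
Qed.

Lemma infty34_bicyclic : @bicyclic 'I_7 (infty_graph 3 4 2).
Proof.
split; first exact (infty_connected 1).
by rewrite (@card_edges 7) card_ord !big_ord_recl !big_ord0.
Qed.

Lemma infty_neg_Bplus (q : nat) :
  bicyclic (infty_graph 3 q.+3 2) -> Bplus (underlying (infty_neg q.+3)).
Proof.
by move=> bic; split=> //; exists 3, q.+3, 2; split=> //; apply: attach_trees_refl.
Qed.

(** * Realization of all ranks *)

Section Realization.
Variable R : realFieldType.

(* [y] witnesses that a pendant vertex at [v] will not increase the rank; it is
   inherited by the larger graph, so that any number of them can be attached. *)
Definition twinnable (n r : nat) : Prop :=
  exists (S : signed_graph 'I_n) (v : 'I_n) (y : 'rV[R]_n),
    [/\ Bplus (underlying S), unbalanced S, \rank (adjmx R S) = r,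
        y *m adjmx R S = delta_mx 0 v & y 0 v = 0].

Lemma twinnableD (n r j : nat) : twinnable n r -> twinnable (j + n) r.
Proof.
move=> tw; elim: j => // j [S [v [y [bp unb rk yA yv]]]].
have [yA' yv'] := pendant_twin_witness yA yv.
exists (pendant S v), (lift ord0 v), (row_mx (0 : 'M_1) y); rewrite adjmx_pendant;
  split=> //.
- exact: pendant_Bplus.
- exact: pendant_unbalanced.
- by rewrite -rk; apply: rank_pendant_twin yA yv; apply: adjmx_sym.
Qed.

Let infty33 : signed_graph 'I_6 := infty_neg 3.
Let infty34 : signed_graph 'I_7 := infty_neg 4.

Lemma infty33_unit : adjmx R infty33 \in unitmx.
Proof.
rewrite -row_free_unit; apply: inj_row_free => u /rowP e.
move: (e ord0)
  (e (lift ord0 ord0))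
  (e (lift ord0 (lift ord0 ord0)))
  (e (lift ord0 (lift ord0 (lift ord0 ord0))))
  (e (lift ord0 (lift ord0 (lift ord0 (lift ord0 ord0)))))
  (e (lift ord0 (lift ord0 (lift ord0 (lift ord0 (lift ord0 ord0)))))).
rewrite !mxE !big_ord_recl !big_ord0 !mxE /= => e0 e1 e2 e3 e4 e5.
apply/rowP=> i; rewrite mxE.
by do 6 (have [{}i ->|->] := unliftP ord0 i; [|lra]); case: i.
Qed.

Lemma infty33_pendant_unit :
  adjmx R (pendant infty33 (lift ord0 (lift ord0 ord0))) \in unitmx.
Proof.
rewrite adjmx_pendant -row_free_unit; apply: inj_row_free => u /rowP e.
move: (e ord0)
  (e (lift ord0 ord0))
  (e (lift ord0 (lift ord0 ord0)))
  (e (lift ord0 (lift ord0 (lift ord0 ord0))))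
  (e (lift ord0 (lift ord0 (lift ord0 (lift ord0 ord0)))))
  (e (lift ord0 (lift ord0 (lift ord0 (lift ord0 (lift ord0 ord0))))))
  (e (lift ord0 (lift ord0 (lift ord0 (lift ord0 (lift ord0 (lift ord0 ord0))))))).
rewrite !mxE !big_ord_recl !big_ord0.
rewrite !(pendant_mx_lift, pendant_mx_0lift, pendant_mx_lift0, pendant_mx_00) !mxE /= => e0 e1 e2 e3 e4 e5 e6.
apply/rowP=> i; rewrite mxE.
by do 7 (have [{}i ->|->] := unliftP ord0 i; [|lra]); case: i.
Qed.

(** As [unitmx_double_pendant] grows the path by two vertices, two consecutive lengths are carried
    through the induction. *)
Lemma nonsingular_tail (m : nat) :
  exists (S : signed_graph 'I_(m + 6)) (v : 'I_(m + 6)),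
    [/\ Bplus (underlying S), unbalanced S, adjmx R S \in unitmx
      & adjmx R (pendant S v) \in unitmx].
Proof.
elim: m => [|m [S [v [bp unb u1 u2]]]].
  exists infty33, (lift ord0 (lift ord0 ord0)); split.
  - exact (@infty_neg_Bplus 0 infty33_bicyclic).
  - exact (@infty_neg_unbalanced 0).
  - exact: infty33_unit.
  - exact: infty33_pendant_unit.
exists (pendant S v), ord0; split=> //.
- exact: pendant_Bplus.
- exact: pendant_unbalanced.
- by rewrite !adjmx_pendant; apply: unitmx_double_pendant.
Qed.

Lemma twinnable_full (m : nat) : twinnable (m + 7) (m + 7).
Proof.
have [S [v [bp unb _ u]]] := nonsingular_tail m.
(* The row of a pendant vertex is the unit row of its neighbour, so [ord0] itself yields the
   witness. *)
rewrite addnS; exists (pendant S v), (lift ord0 v), (delta_mx 0 ord0); split.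
- exact: pendant_Bplus.
- exact: pendant_unbalanced.
- exact: mxrank_unit.
- rewrite -rowE adjmx_pendant; apply/rowP=> j; rewrite [LHS]mxE [RHS]mxE eqxx.
  have [j0 ->|->] := unliftP ord0 j; last by rewrite pendant_mx_00 eq_liftF.
  by rewrite (pendant_mx_0lift _ _ j0) (inj_eq lift_inj).
- by rewrite mxE eqxx eq_sym eq_liftF.
Qed.

Lemma twinnable7_6 : twinnable 7 6.
Proof.
have bp : Bplus (underlying infty34) := @infty_neg_Bplus 1 infty34_bicyclic.
have unb : unbalanced infty34 := @infty_neg_unbalanced 1.
pose o2 : 'I_7 := lift ord0 (lift ord0 ord0).
pose o3 : 'I_7 := lift ord0 (lift ord0 (lift ord0 ord0)).
pose o4 : 'I_7 := lift ord0 (lift ord0 (lift ord0 (lift ord0 ord0))).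
pose o5 : 'I_7 := lift ord0 (lift ord0 (lift ord0 (lift ord0 (lift ord0 ord0)))).
pose o6 : 'I_7 := lift ord0 (lift ord0 (lift ord0
  (lift ord0 (lift ord0 (lift ord0 ord0))))).
(* The opposite vertices 3 and 5 of the square share the neighbours 4 and 6, and 3 is also adjacent
   to 2, so their rows differ by the unit row of 2. *)
exists infty34, o2, (delta_mx 0 o3 - delta_mx 0 o5); split=> //.
- apply/eqP; rewrite eqn_leq rank_adjmx_ge6 // andbT -ltnS ltn_neqAle rank_leq_row andbT.
  (* Labels 4 and 6 are opposite vertices of the positive square, hence twins. *)
  apply/negP=> fA.
  have /eqP : (delta_mx 0 o4 - delta_mx 0 o6 : 'rV[R]_7) *m adjmx R infty34 = 0.
    rewrite mulmxBl -!rowE; apply/rowP=> j; rewrite !mxE.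
    by do 7 (have [{}j ->|->] := unliftP ord0 j; [|by rewrite /= ?subrr]); case: j.
  rewrite mulmx_free_eq0 // => /eqP/rowP/(_ o4); rewrite !mxE /= subr0 => /eqP.
  by rewrite oner_eq0.
- rewrite mulmxBl -!rowE; apply/rowP=> j; rewrite !mxE.
  by do 7 (have [{}j ->|->] := unliftP ord0 j; [|by rewrite /= ?subrr ?subr0]); case: j.
- by rewrite !mxE /= subrr.
Qed.
End Realization.
Local Close Scope ring_scope.

Theorem theorem5p4 (R : realFieldType) (n : nat) (hn : 7 <= n) (k : nat) :
  (exists S : signed_graph 'I_n,
     [/\ Bplus (underlying S), unbalanced S & eta R S = k]) <->
  k <= n - 6.
Proof.
split=> [[S [bp unb <-]]|kn].
  by rewrite eta_rank leq_sub2l // rank_adjmx_ge6.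
suff [S [_ [_ [bp unb rk _ _]]]] : twinnable R n (n - k).
  by exists S; split=> //; rewrite eta_rank rk; lia.
have [k6|k6] := eqVneq k (n - 6).
  have -> : n - k = 6 by lia.
  by rewrite (_ : n = (n - 7) + 7); [apply/twinnableD/twinnable7_6|lia].
(* A nonsingular graph on [n - k] vertices, at least 7 of them, receives [k] further pendant
   vertices. *)
rewrite (_ : n - k = (n - k - 7) + 7); last by lia.
rewrite {1}(_ : n = k + ((n - k - 7) + 7)); last by lia.
exact/twinnableD/twinnable_full.
Qed.
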